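(* Let $\Bbbk$ be an algebraically closed field of characteristic zero, let $\mathcal{A}$ be the Kac–Paljutkin Hopf algebra over $\Bbbk$ and let $q\in\Bbbk$ be a primitive fourth root of unity. All partial actions of $\mathcal{A}$ on $\Bbbk$, namely $\varepsilon_{\mathcal{A}}$, $\lambda_\zeta$ for $\zeta\in\{q,-q\}$, and $\lambda_N^0$ for each subgroup $N$ of $G(\mathcal{A})$, are symmetric.
   Context: A partial action of a Hopf algebra $H$ on its base field $\Bbbk$ is a linear map $\lambda:H\to\Bbbk$ with $\lambda(1_H)=1$ and $\lambda(u)\lambda(v)=\lambda(u_1)\lambda(u_2v)$ for all $u,v\in H$ (Sweedler notation $\Delta(u)=u_1\otimes u_2$). It is symmetric if moreover $\lambda(u)\lambda(v)=\lambda(u_1v)\lambda(u_2)$ for all $u,v\in H$. The Kac–Paljutkin algebra $\mathcal{A}$ is the $8$-dimensional Hopf algebra generated as an algebra by $g,h,x$ with relations $g^2=h^2=1$, $x^2=\tfrac12(1+g+h-gh)$, $hg=gh$, $xh=gx$, $xg=hx$; it has linear basis $\mathcal{B}_{\mathcal{A}}=\{1,g,h,gh,x,gx,hx,ghx\}$. Its coproduct is determined by $g,h$ being grouplike and $\Delta(x)=\tfrac12(x\otimes x+x\otimes gx+hx\otimes x-hx\otimes gx)$; $\varepsilon(k)=1$ for all $k\in\mathcal{B}_{\mathcal{A}}$; $S(g)=g$, $S(h)=h$, $S(x)=x$. Its group of grouplike elements is $G(\mathcal{A})=\{1,g,h,gh\}\cong C_2\times C_2$. For a subgroup $N$ of $G(\mathcal{A})$,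 the linear map $\lambda_N^0:\mathcal{A}\to\Bbbk$ is given by $\lambda_N^0(t)=1$ if $t\in N$ and $\lambda_N^0(t)=0$ if $t\in\mathcal{B}_{\mathcal{A}}\setminus N$. For $\zeta\in\{q,-q\}$, the linear map $\lambda_\zeta:\mathcal{A}\to\Bbbk$ is given by $\lambda_\zeta(1)=\lambda_\zeta(gh)=1$, $\lambda_\zeta(g)=\lambda_\zeta(h)=0$, $\lambda_\zeta(x)=\lambda_\zeta(ghx)=\tfrac{1+\zeta}{2}$, $\lambda_\zeta(gx)=\lambda_\zeta(hx)=\tfrac{1-\zeta}{2}$. The maps $\varepsilon_{\mathcal{A}},\lambda_\zeta,\lambda_N^0$ are exactly the partial actions of $\mathcal{A}$ on $\Bbbk$. *)

(* Defs.v *)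
From HB Require Import structures.
From mathcomp Require Import all_boot all_order all_algebra falgebra.
From mathcomp Require Import ring.

Set Implicit Arguments.
Unset Strict Implicit.
Unset Printing Implicit Defensive.

Import GRing.Theory VectorInternalTheory.
Local Open Scope ring_scope.

(* The tensor product of two finite dimensional spaces is modelled by the     *)
(* matrices of coordinates in the reference bases given by [r2v] and [v2r].   *)
Section Tensor.
Variable k : fieldType.
Implicit Types U V : vectType k.

Definition tensor U V : Type := 'M[k]_(dim U, dim V).

Definition pure U V (u : U) (v : V) : tensor U V := (v2r u)^T *m v2r v.

(* The linear map U (x) V -> W induced by a bilinear f : U -> V -> W.  For    *)
(* t = Delta(u), [sweedler f t] is what Sweedler notation writes f(u_1, u_2). *)
Definition sweedler U V (W : lmodType k) (f : U -> V -> W) (t : tensor U V) :=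
  \sum_i \sum_j t i j *: f (r2v (delta_mx 0 i)) (r2v (delta_mx 0 j)).

Definition tensor_mul (A : falgType k) (s t : tensor A A) : tensor A A :=
  sweedler (fun a b => sweedler (fun c d => pure (a * c) (b * d)) t) s.

Lemma sweedler_pure U V (W : lmodType k) (f : U -> V -> W) u v :
  (forall v', linear (f^~ v')) -> (forall u', linear (f u')) ->
  sweedler f (pure u v) = f u v.
Proof.
move=> linl linr.
pose fl v' : {linear U -> W} :=
  HB.pack (f^~ v') (GRing.isLinear.Build k U W *:%R _ (linl v')).
pose fr u' : {linear V -> W} :=
  HB.pack (f u') (GRing.isLinear.Build k V W *:%R _ (linr u')).
have eU : u = \sum_i v2r u 0 i *: r2v (delta_mx 0 i).
  apply: v2r_inj; rewrite [LHS]row_sum_delta linear_sum /=.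
  by apply: eq_bigr => i _; rewrite linearZ /= r2vK.
have eV : v = \sum_i v2r v 0 i *: r2v (delta_mx 0 i).
  apply: v2r_inj; rewrite [LHS]row_sum_delta linear_sum /=.
  by apply: eq_bigr => i _; rewrite linearZ /= r2vK.
rewrite [in RHS]eU -[f _ v]/(fl v _) linear_sum; apply: eq_bigr => i _.
rewrite linearZ /= [in RHS]eV -[f _ (\sum_(j < _) _)]/(fr _ _) linear_sum.
rewrite scaler_sumr; apply: eq_bigr => j _.
by rewrite linearZ /= scalerA !mxE big_ord1 !mxE.
Qed.

Lemma pure_linearl U V (v : V) : linear (fun u : U => pure u v).
Proof. by move=> a u w; rewrite /pure !linearP /= mulmxDl -scalemxAl. Qed.

Lemma pure_linearr U V (u : U) : linear (pure u : V -> tensor U V).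
Proof. by move=> a v w; rewrite /pure linearP /= mulmxDr -scalemxAr. Qed.

Lemma sweedler_linear U V (W : lmodType k) (f : U -> V -> W) :
  linear (sweedler f).
Proof.
move=> a s t; rewrite /sweedler scaler_sumr -big_split; apply: eq_bigr => i _.
rewrite scaler_sumr -big_split; apply: eq_bigr => j _ /=.
by rewrite !mxE scalerDl scalerA.
Qed.
HB.instance Definition _ U V (W : lmodType k) (f : U -> V -> W) :=
  GRing.isLinear.Build k (tensor U V) W *:%R (sweedler f) (sweedler_linear f).

Lemma eq_sweedler U V (W : lmodType k) (f f' : U -> V -> W) t :
  (forall a b, f a b = f' a b) -> sweedler f t = sweedler f' t.
Proof. by move=> ff'; apply: eq_bigr => i _; apply: eq_bigr => j _; rewrite ff'. Qed.

Lemma linear_sweedler U V (W W' : lmodType k) (l : {linear W -> W'})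
    (f : U -> V -> W) t :
  l (sweedler f t) = sweedler (fun a b => l (f a b)) t.
Proof.
rewrite linear_sum; apply: eq_bigr => i _; rewrite linear_sum.
by apply: eq_bigr => j _; rewrite linearZ.
Qed.

Lemma sweedlerD U V (W : lmodType k) (f f' : U -> V -> W) t :
  sweedler (fun a b => f a b + f' a b) t = sweedler f t + sweedler f' t.
Proof.
rewrite -big_split; apply: eq_bigr => i _; rewrite -big_split.
by apply: eq_bigr => j _; rewrite scalerDr.
Qed.

Lemma sweedlerZ U V (W : lmodType k) (f : U -> V -> W) c t :
  sweedler (fun a b => c *: f a b) t = c *: sweedler f t.
Proof.
rewrite scaler_sumr; apply: eq_bigr => i _; rewrite scaler_sumr.
by apply: eq_bigr => j _; rewrite !scalerA mulrC.
Qed.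

Definition v2r_coord U (i : 'I_(dim U)) (u : U) : k^o := v2r u 0 i.
Fact v2r_coord_linear U (i : 'I_(dim U)) : linear (v2r_coord i).
Proof. by move=> a u v; rewrite /v2r_coord linearP !mxE. Qed.
HB.instance Definition _ U (i : 'I_(dim U)) :=
  GRing.isLinear.Build k U k^o *:%R (v2r_coord i) (v2r_coord_linear i).

Lemma tensor_sep U V (I J : Type) (phi : I -> {linear U -> k^o})
    (psi : J -> {linear V -> k^o}) :
  (forall u, (forall i, phi i u = 0) -> u = 0) ->
  (forall v, (forall j, psi j v = 0) -> v = 0) ->
  forall s t : tensor U V,
  (forall i j, sweedler (fun a b => phi i a * psi j b : k^o) s =
               sweedler (fun a b => phi i a * psi j b : k^o) t) -> s = t.
Proof.
move=> phi0 psi0 s t st; apply/eqP; rewrite -subr_eq0; apply/eqP.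
set d := s - t.
have dE i j : sweedler (fun a b => phi i a * psi j b : k^o) d = 0.
  by rewrite linearB /= st subrr.
have w0 j : sweedler (fun a b => psi j b *: a) d = 0.
  apply: phi0 => i; rewrite linear_sweedler -[RHS](dE i j).
  by apply: eq_sweedler => a b; rewrite linearZ mulrC.
apply/matrixP=> i j; rewrite [RHS]mxE.
have : sweedler (fun a b => v2r a 0 i *: b) d = 0.
  apply: psi0 => j'; rewrite linear_sweedler.
  have := congr1 (fun u => v2r u 0 i : k^o) (w0 j').
  rewrite -[LHS]/(v2r_coord i _) linear_sweedler /= => e.
  transitivity ((v2r (0 : U) 0 i)); last by rewrite linear0 mxE.
  rewrite -{}e; apply: eq_sweedler => a b.
  by rewrite !linearZ; apply: mulrC.
move/(congr1 (fun v : V => v2r v 0 j)); rewrite linear0 mxE => <-.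
rewrite linear_sum summxE (bigD1 i) //= [X in _ + X]big1 ?addr0; last first.
  move=> i' i'i; rewrite linear_sum summxE big1 // => j' _.
  by rewrite !linearZ /= !r2vK !mxE eqxx eq_sym (negPf i'i) /= mul0r mulr0.
rewrite linear_sum summxE (bigD1 j) //= [X in _ + X]big1 ?addr0; last first.
  move=> j' j'j.
  by rewrite !linearZ /= !r2vK !mxE !eqxx eq_sym (negPf j'j) /= !mulr0.
by rewrite !linearZ /= !r2vK !mxE !eqxx /= !mulr1.
Qed.

End Tensor.

Record hopfAlgebra (k : fieldType) := HopfAlgebra {
  hopf_sort :> falgType k;
  comul : {linear hopf_sort -> tensor hopf_sort hopf_sort};
  counit : {linear hopf_sort -> k^o};
  antipode : {linear hopf_sort -> hopf_sort};
  (* the left hand side re-associates H (x) (H (x) H) as (H (x) H) (x) H *)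
  comulA : forall u,
    sweedler (fun a b =>
      sweedler (fun b1 b2 => pure (pure a b1) b2) (comul b)) (comul u) =
    sweedler (fun a b => pure (comul a) b) (comul u);
  comul_counitl : forall u, sweedler (fun a b => counit a *: b) (comul u) = u;
  comul_counitr : forall u, sweedler (fun a b => counit b *: a) (comul u) = u;
  comul1 : comul 1 = pure 1 1;
  comulM : forall u v, comul (u * v) = tensor_mul (comul u) (comul v);
  counit1 : counit 1 = 1;
  counitM : forall u v, counit (u * v) = counit u * counit v;
  antipodel : forall u,
    sweedler (fun a b => antipode a * b) (comul u) = counit u *: 1;
  antipoder : forall u,
    sweedler (fun a b => a * antipode b) (comul u) = counit u *: 1 }.

Arguments comul {k h}.
Arguments counit {k h}.
Arguments antipode {k h}.

Section PartialAction.
Variables (k : fieldType) (H : hopfAlgebra k).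

Definition partial_action (lambda : {linear H -> k^o}) : Prop :=
  lambda 1 = 1 /\
  forall u v : H,
    lambda u * lambda v =
    sweedler (fun u1 u2 => lambda u1 * lambda (u2 * v) : k^o) (comul u).

Definition symmetric_partial_action (lambda : {linear H -> k^o}) : Prop :=
  partial_action lambda /\
  forall u v : H,
    lambda u * lambda v =
    sweedler (fun u1 u2 => lambda (u1 * v) * lambda u2 : k^o) (comul u).

Definition grouplike (u : H) : Prop := u != 0 /\ comul u = pure u u.

Definition grouplike_subgroup (N : {pred H}) : Prop :=
  (forall u, u \in N -> grouplike u) /\ divr_closed N.

(* the linear map sending the i-th vector of the basis b to c_i *)
Definition basis_map n (b : n.-tuple H) (c : n.-tuple k) (u : H) : k^o :=
  \sum_(i < n) coord b i u * tnth c i.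

Fact basis_map_linear n (b : n.-tuple H) (c : n.-tuple k) :
  linear (basis_map b c).
Proof.
move=> a u v; rewrite /basis_map scaler_sumr -big_split /=.
by apply: eq_bigr => i _; rewrite linearD linearZ /= mulrDl -mulrA.
Qed.
HB.instance Definition _ n (b : n.-tuple H) (c : n.-tuple k) :=
  GRing.isLinear.Build k H k^o *:%R (basis_map b c) (basis_map_linear b c).

End PartialAction.

Section KacPaljutkin.
Variables (k : fieldType) (A : hopfAlgebra k) (g h x : A).

Definition kp_basis : 8.-tuple A :=
  [tuple 1; g; h; g * h; x; g * x; h * x; g * h * x].

Record kac_paljutkin : Prop := KacPaljutkin {
  kp_gg : g ^+ 2 = 1;
  kp_hh : h ^+ 2 = 1;
  kp_xx : x ^+ 2 = 2^-1 *: (1 + g + h - g * h);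
  kp_hg : h * g = g * h;
  kp_xh : x * h = g * x;
  kp_xg : x * g = h * x;
  kp_basisP : basis_of fullv kp_basis;
  kp_comul_g : comul g = pure g g;
  kp_comul_h : comul h = pure h h;
  kp_comul_x :
    comul x = 2^-1 *: (pure x x + pure x (g * x) + pure (h * x) x
                       - pure (h * x) (g * x));
  kp_counitP : forall t, t \in kp_basis -> counit t = 1;
  kp_antipode_g : antipode g = g;
  kp_antipode_h : antipode h = h;
  kp_antipode_x : antipode x = x }.

Definition lambda_zeta (zeta : k) : {linear A -> k^o} :=
  basis_map kp_basis
    [tuple 1; 0; 0; 1;
       (1 + zeta) / 2; (1 - zeta) / 2; (1 - zeta) / 2; (1 + zeta) / 2].

Definition lambda_sub (N : {pred A}) : {linear A -> k^o} :=
  basis_map kp_basis (map_tuple (fun t => (t \in N)%:R) kp_basis).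

End KacPaljutkin.

(* A model of [kac_paljutkin] when 2 is invertible: the value of u at         *)
(* (c, s, t) is the coefficient of e_{s,t} x^c in u, where e_{s,t} is the     *)
(* idempotent of k[g, h] on which g acts by (-1)^s and h by (-1)^t.           *)
Definition kp (k : fieldType) : Type := {ffun bool * bool * bool -> k^o}.

Section Model.
Variable k : fieldType.
HB.instance Definition _ := Vector.on (kp k).
Implicit Types u v w : kp k.

Definition sg (b : bool) : k := (-1) ^+ b.

Definition kp_mul u v : kp k :=
  [ffun p : bool * bool * bool => let: (c, s, t) := p in
    if c then u (false, s, t) * v (true, s, t) + u (true, s, t) * v (false, t, s)
    else u (false, s, t) * v (false, s, t)
         + sg (s && t) * (u (true, s, t) * v (true, t, s)) : k^o].
Definition kp_one : kp k :=
  [ffun p : bool * bool * bool => (~~ p.1.1)%:R : k^o].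

Fact kp_mulA : associative kp_mul.
Proof.
move=> u v w; apply/ffunP=> -[[[] []] []]; rewrite !ffunE /sg /=; ring.
Qed.
Fact kp_mul1 : left_id kp_one kp_mul.
Proof.
move=> u; apply/ffunP=> -[[[] []] []]; rewrite !ffunE /sg /=; ring.
Qed.
Fact kp_mul1r : right_id kp_one kp_mul.
Proof.
move=> u; apply/ffunP=> -[[[] []] []]; rewrite !ffunE /sg /=; ring.
Qed.
Fact kp_mulDl : left_distributive kp_mul +%R.
Proof.
move=> u v w; apply/ffunP=> -[[[] []] []]; rewrite !ffunE /sg /=; ring.
Qed.
Fact kp_mulDr : right_distributive kp_mul +%R.
Proof.
move=> u v w; apply/ffunP=> -[[[] []] []]; rewrite !ffunE /sg /=; ring.
Qed.
Fact kp_one_neq0 : kp_one != 0.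
Proof.
by apply/eqP => /ffunP/(_ (false, false, false))/eqP; rewrite !ffunE /= oner_eq0.
Qed.
HB.instance Definition _ := GRing.Zmodule_isNzRing.Build (kp k)
  kp_mulA kp_mul1 kp_mul1r kp_mulDl kp_mulDr kp_one_neq0.
Lemma kp_mulE u v : u * v = kp_mul u v. Proof. by []. Qed.
Lemma kp_oneE : 1 = kp_one. Proof. by []. Qed.
Fact kp_scalerAl (a : k) u v : a *: (u * v) = a *: u * v.
Proof.
rewrite !kp_mulE; apply/ffunP=> -[[[] []] []]; rewrite !ffunE /sg /= /GRing.scale/=; ring.
Qed.
Fact kp_scalerAr (a : k) u v : a *: (u * v) = u * (a *: v).
Proof.
rewrite !kp_mulE; apply/ffunP=> -[[[] []] []]; rewrite !ffunE /sg /= /GRing.scale/=; ring.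
Qed.
HB.instance Definition _ := GRing.LSemiModule_isLSemiAlgebra.Build k (kp k) kp_scalerAl.
HB.instance Definition _ := GRing.LSemiAlgebra_isSemiAlgebra.Build k (kp k) kp_scalerAr.
HB.instance Definition _ := Algebra_isFalgebra.Build k (kp k).

Definition cd (p : bool * bool * bool) (u : kp k) : k^o := u p.
Fact cd_linear p : linear (cd p).
Proof. by move=> a u v; rewrite /cd !ffunE. Qed.
HB.instance Definition _ p :=
  GRing.isLinear.Build k (kp k) k^o *:%R (cd p) (cd_linear p).

Lemma cd0 u : (forall p, cd p u = 0) -> u = 0.
Proof. by move=> u0; apply/ffunP=> p; rewrite ffunE; apply: u0. Qed.

Definition ee (p : bool * bool * bool) : kp k := [ffun q => (q == p)%:R : k^o].

Definition ev (p p' : bool * bool * bool) :=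
  sweedler (fun a b : kp k => a p * b p' : k^o).

HB.instance Definition _ p p' := GRing.isLinear.Build k (tensor (kp k) (kp k)) k^o *:%R
  (ev p p') (sweedler_linear _).

Lemma ev_pure p p' u v : ev p p' (pure u v) = u p * v p'.
Proof.
rewrite /ev sweedler_pure // => [b|b] a c d; rewrite !ffunE /GRing.scale /=; ring.
Qed.

Lemma ev_inj (s t : tensor (kp k) (kp k)) :
  (forall p p', ev p p' s = ev p p' t) -> s = t.
Proof. exact: (tensor_sep (phi := cd) (psi := cd) cd0 cd0). Qed.

Definition tw (p p' : bool * bool * bool) : k :=
  if p.1.1 == p'.1.1 then sg [&& p.1.1, p.2 & p'.1.2] else 0.
Definition mulp (p p' : bool * bool * bool) :=
  (p.1.1, addb p.1.2 p'.1.2, addb p.2 p'.2).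

Definition kp_comul u : tensor (kp k) (kp k) :=
  \sum_p \sum_p' (tw p p' * u (mulp p p')) *: pure (ee p) (ee p').
Fact kp_comul_linear : linear kp_comul.
Proof.
move=> a u v; rewrite /kp_comul scaler_sumr -big_split; apply: eq_bigr => p _.
rewrite scaler_sumr -big_split; apply: eq_bigr => q _ /=.
by rewrite scalerA -scalerDl !ffunE; congr (_ *: _); rewrite /GRing.scale /=; ring.
Qed.
HB.instance Definition _ :=
  GRing.isLinear.Build k (kp k) (tensor (kp k) (kp k)) *:%R kp_comul kp_comul_linear.

Lemma ev_comul p p' u : ev p p' (kp_comul u) = tw p p' * u (mulp p p').
Proof.
rewrite /kp_comul linear_sum (bigD1 p) //= [X in _ + X]big1 ?addr0 => [|q qp].
  rewrite linear_sum (bigD1 p') //= [X in _ + X]big1 ?addr0 => [|q qp].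
    by rewrite linearZ /= ev_pure !ffunE !eqxx !mulr1; apply: mulr1.
  by rewrite linearZ /= ev_pure !ffunE [p' == q]eq_sym (negPf qp) mulr0 scaler0.
rewrite linear_sum big1 // => q' _.
by rewrite linearZ /= ev_pure !ffunE [p == q]eq_sym (negPf qp) mul0r scaler0.
Qed.

Definition kp_counit u : k^o := u (false, false, false) + u (true, false, false).
Fact kp_counit_linear : linear kp_counit.
Proof. by move=> a u v; rewrite /kp_counit !ffunE /GRing.scale /=; ring. Qed.
HB.instance Definition _ :=
  GRing.isLinear.Build k (kp k) k^o *:%R kp_counit kp_counit_linear.

Definition kp_antipode u : kp k :=
  [ffun p : bool * bool * bool =>
     if p.1.1 then u (p.1.1, p.2, p.1.2) else u p].
Fact kp_antipode_linear : linear kp_antipode.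
Proof. by move=> a u v; apply/ffunP=> -[[[] s] t]; rewrite !ffunE. Qed.
HB.instance Definition _ :=
  GRing.isLinear.Build k (kp k) (kp k) *:%R kp_antipode kp_antipode_linear.


Lemma kp_comul_counitl u : sweedler (fun a b => kp_counit a *: b) (kp_comul u) = u.
Proof.
apply/ffunP=> p; rewrite -[LHS]/(cd p _) linear_sweedler.
transitivity (ev (false, false, false) p (kp_comul u)
              + ev (true, false, false) p (kp_comul u)).
  rewrite -sweedlerD; apply: eq_sweedler => a b.
  by rewrite /= /cd /kp_counit !ffunE /GRing.scale /= mulrDl.
rewrite !ev_comul /tw /mulp; case: p => [[[] []] []] /=; rewrite /sg /=; ring.
Qed.

Lemma kp_comul_counitr u : sweedler (fun a b => kp_counit b *: a) (kp_comul u) = u.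
Proof.
apply/ffunP=> p; rewrite -[LHS]/(cd p _) linear_sweedler.
transitivity (ev p (false, false, false) (kp_comul u)
              + ev p (true, false, false) (kp_comul u)).
  rewrite -sweedlerD; apply: eq_sweedler => a b.
  by rewrite /= /cd /kp_counit !ffunE /GRing.scale /=; ring.
rewrite !ev_comul /tw /mulp; case: p => [[[] []] []] /=; rewrite /sg /=; ring.
Qed.

Lemma kp_comul1 : kp_comul 1 = pure 1 1.
Proof.
apply: ev_inj => p p'; rewrite ev_comul ev_pure kp_oneE !ffunE /= /tw.
case: p p' => [[[] []] []] [[[] []] []] /=; rewrite /sg /=; ring.
Qed.

Lemma kp_counit1 : kp_counit 1 = 1.
Proof. by rewrite /kp_counit !ffunE /= addr0. Qed.

Lemma kp_counitM u v : kp_counit (u * v) = kp_counit u * kp_counit v.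
Proof. rewrite /kp_counit kp_mulE !ffunE /sg /=; ring. Qed.

Lemma kp_antipodel u :
  sweedler (fun a b => kp_antipode a * b) (kp_comul u) = kp_counit u *: 1.
Proof.
apply/ffunP=> p; rewrite -[LHS]/(cd p _) linear_sweedler.
case: p => [[c s] t]; rewrite !ffunE /kp_counit /=; case: c.
  transitivity (ev (false, s, t) (true, s, t) (kp_comul u)
                + ev (true, t, s) (false, t, s) (kp_comul u)).
    rewrite -sweedlerD; apply: eq_sweedler => a b.
    by rewrite /= /cd kp_mulE !ffunE.
  by rewrite !ev_comul /tw /= !mul0r addr0 scaler0.
transitivity (ev (false, s, t) (false, s, t) (kp_comul u)
              + sg (s && t) *: ev (true, t, s) (true, t, s) (kp_comul u)).
  rewrite -sweedlerZ -sweedlerD; apply: eq_sweedler => a b.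
  by rewrite /= /cd kp_mulE !ffunE.
rewrite !ev_comul /tw /mulp /GRing.scale /= !addbb.
case: s t => [] []; rewrite /sg /=; ring.
Qed.

Lemma kp_antipoder u :
  sweedler (fun a b => a * kp_antipode b) (kp_comul u) = kp_counit u *: 1.
Proof.
apply/ffunP=> p; rewrite -[LHS]/(cd p _) linear_sweedler.
case: p => [[c s] t]; rewrite !ffunE /kp_counit /=; case: c.
  transitivity (ev (false, s, t) (true, t, s) (kp_comul u)
                + ev (true, s, t) (false, t, s) (kp_comul u)).
    rewrite -sweedlerD; apply: eq_sweedler => a b.
    by rewrite /= /cd kp_mulE !ffunE.
  by rewrite !ev_comul /tw /= !mul0r addr0 scaler0.
transitivity (ev (false, s, t) (false, s, t) (kp_comul u)
              + sg (s && t) *: ev (true, s, t) (true, s, t) (kp_comul u)).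
  rewrite -sweedlerZ -sweedlerD; apply: eq_sweedler => a b.
  by rewrite /= /cd kp_mulE !ffunE.
rewrite !ev_comul /tw /mulp /GRing.scale /= !addbb.
case: s t => [] []; rewrite /sg /=; ring.
Qed.

Lemma cd_mul p u v :
  (u * v) p = \sum_(d : bool)
    (if d then (if p.1.1 then 1 else sg (p.1.2 && p.2)) else 1)
    * (u (d, p.1.2, p.2) * v (if d then (~~ p.1.1, p.2, p.1.2) else p)).
Proof.
rewrite big_bool kp_mulE !ffunE; case: p => [[[] s] t] /=; ring.
Qed.

Lemma evZ p p' (c : k^o) t :
  c *: ev p p' t = sweedler (fun a b : kp k => c *: (a p * b p' : k^o)) t.
Proof. by rewrite sweedlerZ. Qed.

Definition ev3 p p' r :=
  sweedler (fun (S : tensor (kp k) (kp k)) c => ev p p' S * cd r c : k^o).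
HB.instance Definition _ p p' r :=
  GRing.isLinear.Build k (tensor (tensor (kp k) (kp k)) (kp k)) k^o *:%R
  (ev3 p p' r) (sweedler_linear _).
Lemma ev3_pure p p' r S c : ev3 p p' r (pure S c) = ev p p' S * cd r c.
Proof.
rewrite /ev3 sweedler_pure // => b a s t; rewrite linearP /= /GRing.scale /=; ring.
Qed.

Lemma kp_comulA u :
  sweedler (fun a b =>
      sweedler (fun b1 b2 => pure (pure a b1) b2) (kp_comul b)) (kp_comul u) =
  sweedler (fun a b => pure (kp_comul a) b) (kp_comul u).
Proof.
pose phi (pp : (bool * bool * bool) * (bool * bool * bool))
  : {linear tensor (kp k) (kp k) -> k^o} := ev pp.1 pp.2.
apply: (tensor_sep (phi := phi) (psi := cd)).
- by move=> t t0; apply: ev_inj => p p'; rewrite linear0; apply: (t0 (p, p')).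
- exact: cd0.
move=> [p p'] r; rewrite -[LHS]/(ev3 p p' r _) -[RHS]/(ev3 p p' r _).
transitivity (tw p' r *: ev p (mulp p' r) (kp_comul u)).
  rewrite evZ linear_sweedler; apply: eq_sweedler => a b.
  rewrite [LHS]linear_sweedler.
  transitivity (a p *: ev p' r (kp_comul b)).
    rewrite evZ; apply: eq_sweedler => b1 b2.
    by rewrite /= ev3_pure ev_pure /= /cd /GRing.scale /=; ring.
  by rewrite ev_comul /GRing.scale /=; ring.
transitivity (tw p p' *: ev (mulp p p') r (kp_comul u)); last first.
  rewrite evZ linear_sweedler; apply: eq_sweedler => a b.
  by rewrite /= ev3_pure ev_comul /= /cd /GRing.scale /=; ring.
rewrite !ev_comul /tw /mulp /=.
case: p p' r => [[c s] t] [[c' s'] t'] [[c2 s2] t2] /=; rewrite !addbA.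
by case: c c' c2 => [] [] []; case: s t s' t' s2 t2 => [] [] [] [] [] [] /=;
  rewrite /GRing.scale /sg /=; ring.
Qed.

Lemma kp_comulM u v : kp_comul (u * v) = tensor_mul (kp_comul u) (kp_comul v).
Proof.
apply: ev_inj => p p'; rewrite /tensor_mul linear_sweedler ev_comul.
pose q (d : bool) (p : bool * bool * bool) := (d, p.1.2, p.2).
pose q' (d : bool) (p : bool * bool * bool) :=
  if d then (~~ p.1.1, p.2, p.1.2) else p.
pose z (d : bool) (p : bool * bool * bool) : k :=
  if d then (if p.1.1 then 1 else sg (p.1.2 && p.2)) else 1.
transitivity (\sum_(d : bool) \sum_(d' : bool)
   (z d p * z d' p' * ev (q' d p) (q' d' p') (kp_comul v)) *:
     ev (q d p) (q d' p') (kp_comul u)); last first.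
  rewrite !big_bool /= !evZ -!sweedlerD; apply: eq_sweedler => a b; symmetry.
  rewrite [LHS]linear_sweedler.
  transitivity (\sum_(d : bool) \sum_(d' : bool)
    (z d p * z d' p' * (a (q d p) * b (q d' p'))) *:
      ev (q' d p) (q' d' p') (kp_comul v)).
    rewrite !big_bool /= !evZ -!sweedlerD; apply: eq_sweedler => c d.
    rewrite /= ev_pure !cd_mul !big_bool -/(q _ _) -/(q' _ _) /z /q /q' /=.
    rewrite /GRing.scale /=; ring.
  rewrite !big_bool /GRing.scale /=; ring.
rewrite !big_bool cd_mul big_bool /= !ev_comul /tw /mulp /z /q /q' /=.
case: p p' => [[c s] t] [[c' s'] t'].
by case: c c' => [] []; case: s t s' t' => [] [] [] [] /=;
  rewrite /GRing.scale /sg /=; ring.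
Qed.

Definition kp_hopf : hopfAlgebra k :=
  HopfAlgebra kp_comulA kp_comul_counitl kp_comul_counitr kp_comul1 kp_comulM
    kp_counit1 kp_counitM kp_antipodel kp_antipoder.

Definition kp_g : kp_hopf :=
  [ffun p : bool * bool * bool => if p.1.1 then 0 else sg p.1.2 : k^o].
Definition kp_h : kp_hopf :=
  [ffun p : bool * bool * bool => if p.1.1 then 0 else sg p.2 : k^o].
Definition kp_x : kp_hopf := [ffun p : bool * bool * bool => (p.1.1)%:R : k^o].

Lemma kp_hopfP : 2 != 0 :> k -> kac_paljutkin kp_g kp_h kp_x.
Proof.
move=> two_neq0; split.
- rewrite expr2 kp_mulE kp_oneE; apply/ffunP=> -[[[] []] []];
  by rewrite !ffunE /sg /=; ring.
- rewrite expr2 kp_mulE kp_oneE; apply/ffunP=> -[[[] []] []];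
  by rewrite !ffunE /sg /=; ring.
- rewrite expr2 !kp_mulE kp_oneE; apply/ffunP=> -[[[] []] []];
  rewrite !ffunE /sg /GRing.scale /=; by field.
- rewrite !kp_mulE; apply/ffunP=> -[[[] []] []];
  by rewrite !ffunE /sg /=; ring.
- rewrite !kp_mulE; apply/ffunP=> -[[[] []] []];
  by rewrite !ffunE /sg /=; ring.
- rewrite !kp_mulE; apply/ffunP=> -[[[] []] []];
  by rewrite !ffunE /sg /=; ring.
- rewrite basisEdim; apply/andP; split; last first.
    by rewrite dimvf /dim /= !card_prod !card_bool.
  apply/subvP=> u _.
  pose f c a b : k := 4^-1 * \sum_(s : bool) \sum_(t : bool)
    sg (a && s) * sg (b && t) * (u : kp k) (c, s, t).
  have -> : u = f false false false *: 1 + f false true false *: kp_g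
     + f false false true *: kp_h + f false true true *: (kp_g * kp_h)
     + f true false false *: kp_x + f true true false *: (kp_g * kp_x)
     + f true false true *: (kp_h * kp_x)
     + f true true true *: (kp_g * kp_h * kp_x).
    have four_neq0 : 4 != 0 :> k.
      by rewrite -[4%N]/(2 * 2)%N natrM mulf_neq0.
    rewrite /f !big_bool; apply/ffunP=> p.
    rewrite !kp_mulE kp_oneE !ffunE /GRing.scale /=.
    by case: p => [[[] []] []] /=; rewrite ?ffunE /= /sg /=; field.
  by do ?apply: rpredD; apply: rpredZ; apply: memv_span; rewrite !inE eqxx ?orbT.
- apply: ev_inj => p p'; rewrite ev_comul ev_pure !ffunE /= /tw /mulp.
  by case: p p' => [[[] []] []] [[[] []] []] /=; rewrite /sg /=; ring.
- apply: ev_inj => p p'; rewrite ev_comul ev_pure !ffunE /= /tw /mulp.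
  by case: p p' => [[[] []] []] [[[] []] []] /=; rewrite /sg /=; ring.
- apply: ev_inj => p p'.
  rewrite linearZ linearB !linearD ev_comul /= !ev_pure !kp_mulE /= /tw /mulp.
  case: p p' => [[[] []] []] [[[] []] []] /=;
  rewrite !ffunE /= /sg /GRing.scale /=; by field.
- move=> t; rewrite !inE.
  by do !(case/predU1P => [->|]); last move/eqP=> ->;
   rewrite /= /kp_counit ?kp_mulE ?kp_oneE !ffunE /sg /=; ring.
- by apply/ffunP=> -[[[] []] []]; rewrite !ffunE.
- by apply/ffunP=> -[[[] []] []]; rewrite !ffunE.
- by apply/ffunP=> -[[[] []] []]; rewrite !ffunE.
Qed.
End Model.

Lemma kac_paljutkin_exists (k : fieldType) : 2 != 0 :> k ->
  exists (A : hopfAlgebra k) (g h x : A), kac_paljutkin g h x.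
Proof.
by move=> k2; exists (kp_hopf k), (kp_g k), (kp_h k), (kp_x k); apply: kp_hopfP.
Qed.

(* Main.v *)
Require Import Defs.
From mathcomp Require Import all_boot all_order all_algebra falgebra.
From mathcomp Require Import ring.

(* Both sides of the defining identity are bilinear in (u, v), so it is a system
   of polynomial equations in the values of lambda on the basis.  The equations
   with u grouplike make these values 0 or 1 on g, h, gh, equal to 1 exactly on a
   subgroup of G(A) whose translations preserve lambda.  The equations with u in
   G(A)x and v in G(A) then force lambda to vanish on G(A)x, except that
   lambda = counit is possible for the full subgroup and, for {1, gh}, the values
   p = lambda(x), r = lambda(gx) may also satisfy p + r = 1, p^2 + r^2 = 0, so
   that zeta = 2 p - 1 is a square root of -1.  Conversely, each solution
   satisfies both the identity and its mirror image on the basis. *)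

Set Implicit Arguments.
Unset Strict Implicit.
Unset Printing Implicit Defensive.

Import GRing.Theory.
Local Open Scope ring_scope.

Lemma invr_involution (R : unitRingType) (u : R) : u * u = 1 -> u^-1 = u.
Proof.
move=> uu; have uU : u \is a GRing.unit by apply/unitrP; exists u.
by apply: (mulrI uU); rewrite divrr.
Qed.

(** * Sweedler sums over products, grouplike elements and coordinates *)

Section Sweedler.
Variables (k : fieldType) (H : hopfAlgebra k).
Implicit Types u v : H.

Lemma sweedler_tensor_mul (F : H -> H -> k^o) (s t : tensor H H) :
  (forall b, linear (F^~ b)) -> (forall a, linear (F a)) ->
  sweedler F (tensor_mul s t) =
  sweedler (fun a b => sweedler (fun c d => F (a * c) (b * d)) t) s.
Proof.
move=> linl linr; rewrite /tensor_mul linear_sweedler; apply: eq_sweedler => a b.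
by rewrite linear_sweedler; apply: eq_sweedler => c d; rewrite /= sweedler_pure.
Qed.

Lemma sweedler_comul_grouplikeM (F : H -> H -> k^o) u v :
  (forall b, linear (F^~ b)) -> (forall a, linear (F a)) ->
  comul u = pure u u ->
  sweedler F (comul (u * v)) =
  sweedler (fun c d => F (u * c) (u * d)) (comul v).
Proof.
move=> linl linr uu; rewrite comulM sweedler_tensor_mul // uu.
rewrite sweedler_pure // => [b|a] c s t.
  rewrite -sweedlerZ -sweedlerD; apply: eq_sweedler => y z.
  by rewrite mulrDl -scalerAl linl.
rewrite -sweedlerZ -sweedlerD; apply: eq_sweedler => y z.
by rewrite mulrDl -scalerAl linr.
Qed.

Lemma sweedler_mul_pure (W : lmodType k) (F : H -> H -> W) a b u v :
  (forall b, linear (F^~ b)) -> (forall a, linear (F a)) ->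
  sweedler (fun c d => F (a * c) (b * d)) (pure u v) = F (a * u) (b * v).
Proof.
move=> linl linr; rewrite sweedler_pure // => y c s t.
  by rewrite mulrDr -scalerAr linl.
by rewrite mulrDr -scalerAr linr.
Qed.

Lemma comul_grouplikeM u v :
  comul u = pure u u -> comul v = pure v v ->
  comul (u * v) = pure (u * v) (u * v).
Proof.
have linl := @pure_linearl k H H; have linr := @pure_linearr k H H.
move=> uu vv; rewrite comulM uu vv /tensor_mul sweedler_pure.
- by rewrite sweedler_mul_pure.
- move=> b c s t; rewrite !sweedler_mul_pure // mulrDl -scalerAl; exact: linl.
- move=> b c s t; rewrite !sweedler_mul_pure // mulrDl -scalerAl; exact: linr.
Qed.

Lemma mull_linear (f : H -> k^o) (c : k^o) :
  linear f -> linear (fun a => f a * c).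
Proof. by move=> linf d a b; rewrite linf /GRing.scale /=; ring. Qed.

Lemma mulr_linear (f : H -> k^o) (c : k^o) :
  linear f -> linear (fun a => c * f a).
Proof. by move=> linf d a b; rewrite linf /GRing.scale /=; ring. Qed.

Lemma basis_map_tnth n (b : n.-tuple H) (c : n.-tuple k) (i : 'I_n) :
  free b -> basis_map b c (tnth b i) = tnth c i.
Proof.
move=> fb; rewrite /basis_map (bigD1 i) //= big1 ?addr0 => [|j ji].
  by rewrite (tnth_nth 0) coord_free // eqxx mul1r.
by rewrite (tnth_nth 0) coord_free // eq_sym (negPf ji) mul0r.
Qed.

End Sweedler.

(** * Extension from the basis of the algebra, and coproducts of the basis vectors *)

Section KacPaljutkin.
Variables (k : fieldType) (A : hopfAlgebra k) (g h x : A).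
Hypothesis two_neq0 : 2 != 0 :> k.
Hypothesis A_kp : kac_paljutkin g h x.
Let B := kp_basis g h x.

Lemma kp_free : free B.
Proof. exact: basis_free (kp_basisP A_kp). Qed.

Lemma kp_span_ind (P : A -> Prop) :
  (forall a u v, P u -> P v -> P (a *: u + v)) ->
  (forall t, t \in B -> P t) -> forall u, P u.
Proof.
move=> Plin PB u.
have P0 : P 0.
  have P1 : P 1 by apply: PB; rewrite inE eqxx.
  by rewrite -(addNr 1) -scaleN1r; apply: Plin.
have := memvf u; rewrite -(span_basis (kp_basisP A_kp)) => /coord_span ->.
elim/big_rec: _ => // i v _ Pv; apply: Plin => //.
by apply: PB; rewrite mem_nth.
Qed.

Lemma kp_basis_forall (P : A -> Prop) :
  P 1 -> P g -> P h -> P (g * h) -> P x -> P (g * x) -> P (h * x) ->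
  P (g * h * x) -> forall t, t \in B -> P t.
Proof.
move=> P1 Pg Ph Pgh Px Pgx Phx Pghx t; rewrite !inE.
by do !(case/predU1P => [->|] //); move/eqP=> ->.
Qed.

Lemma kp_linear_ext (f f' : {linear A -> k^o}) :
  (forall t, t \in B -> f t = f' t) -> f =1 f'.
Proof.
move=> ff'; apply: kp_span_ind => // a u v fu fv.
by rewrite !linearP /= fu fv.
Qed.

(** The choice of [F] covers both the defining identity and its mirror image; linearity in [u] comes
    from [comul] and [sweedler]. *)
Lemma kp_bilinear_ext (f : {linear A -> k^o}) (F : A -> A -> A -> k^o) :
  (forall a b, linear (fun v => F v a b)) ->
  (forall v, v \in B -> forall u, u \in B ->
     f u * f v = sweedler (F v) (comul u)) ->
  forall u v, f u * f v = sweedler (F v) (comul u).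
Proof.
move=> linF fF u v; elim/kp_span_ind: u => [a u w IHu IHw|u uB].
  by rewrite !linearP /= mulrDl -IHu -IHw -mulrA.
elim/kp_span_ind: v => [c v w IHv IHw|v vB]; last exact: fF.
rewrite (eq_sweedler _ (fun a b => linF a b c v w)) sweedlerD sweedlerZ -IHv -IHw.
by rewrite linearP /= /GRing.scale /=; ring.
Qed.

Lemma kp_comul_gh : comul (g * h) = pure (g * h) (g * h).
Proof.
exact: comul_grouplikeM (kp_comul_g A_kp) (kp_comul_h A_kp).
Qed.

(** Every basis vector outside G(A) is a grouplike times [x], so this formula gives all four of
    their coproducts. *)
Lemma sweedler_comul_x (F : A -> A -> k^o) u :
  (forall b, linear (F^~ b)) -> (forall a, linear (F a)) ->
  comul u = pure u u ->
  sweedler F (comul (u * x)) =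
  2^-1 * (F (u * x) (u * x) + F (u * x) (u * (g * x)) + F (u * (h * x)) (u * x)
          - F (u * (h * x)) (u * (g * x))).
Proof.
move=> linl linr uu; rewrite sweedler_comul_grouplikeM // (kp_comul_x A_kp).
rewrite linearZ linearB !linearD /= !sweedler_pure //.
all: move=> c d y z; rewrite mulrDr -scalerAr ?linl ?linr //.
Qed.

Lemma kp_gg_word u : u * g * g = u.
Proof. by rewrite -mulrA -expr2 (kp_gg A_kp) mulr1. Qed.
Lemma kp_hh_word u : u * h * h = u.
Proof. by rewrite -mulrA -expr2 (kp_hh A_kp) mulr1. Qed.
Lemma kp_hg_word u : u * h * g = u * g * h.
Proof. by rewrite -!mulrA (kp_hg A_kp). Qed.
Lemma kp_xh_word u : u * x * h = u * g * x.
Proof. by rewrite -!mulrA (kp_xh A_kp). Qed.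
Lemma kp_xg_word u : u * x * g = u * h * x.
Proof. by rewrite -!mulrA (kp_xg A_kp). Qed.
Lemma kp_xx_word u : u * x * x = 2^-1 *: (u + u * g + u * h - u * g * h).
Proof.
by rewrite -mulrA -expr2 (kp_xx A_kp) -scalerAr mulrBr !mulrDr mulr1 mulrA.
Qed.
Let gg : g * g = 1. Proof. by rewrite -expr2 (kp_gg A_kp). Qed.
Let hh : h * h = 1. Proof. by rewrite -expr2 (kp_hh A_kp). Qed.
Let xx : x * x = 2^-1 *: (1 + g + h - g * h).
Proof. by rewrite -expr2 (kp_xx A_kp). Qed.

(* Rewrites a left-associated word to its normal form [g^i h^j x^l]. *)
Definition kp_wordE :=
  (kp_gg_word, kp_hh_word, kp_hg_word, kp_xh_word, kp_xg_word, kp_xx_word,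
   gg, hh, xx, kp_hg A_kp, kp_xh A_kp, kp_xg A_kp).

(** A multirule for arbitrary bilinear [F]: it serves the identity, its mirror image and the
    coordinate test for grouplikes. *)
Lemma kp_sweedlerE (F : A -> A -> k^o) :
  (forall b, linear (F^~ b)) -> (forall a, linear (F a)) ->
  (sweedler F (comul 1) = F 1 1) *
  (sweedler F (comul g) = F g g) *
  (sweedler F (comul h) = F h h) *
  (sweedler F (comul (g * h)) = F (g * h) (g * h)) *
  (sweedler F (comul x) =
   2^-1 * (F x x + F x (g * x) + F (h * x) x - F (h * x) (g * x))) *
  (sweedler F (comul (g * x)) =
   2^-1 * (F (g * x) (g * x) + F (g * x) x + F (g * h * x) (g * x)
           - F (g * h * x) x)) *
  (sweedler F (comul (h * x)) =
   2^-1 * (F (h * x) (h * x) + F (h * x) (g * h * x) + F x (h * x)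
           - F x (g * h * x))) *
  (sweedler F (comul (g * h * x)) =
   2^-1 * (F (g * h * x) (g * h * x) + F (g * h * x) (h * x)
           + F (g * x) (g * h * x) - F (g * x) (h * x))).
Proof.
move=> linl linr; do ?apply: pair.
- by rewrite comul1 sweedler_pure.
- by rewrite (kp_comul_g A_kp) sweedler_pure.
- by rewrite (kp_comul_h A_kp) sweedler_pure.
- by rewrite kp_comul_gh sweedler_pure.
- by rewrite -[x in LHS]mul1r sweedler_comul_x ?comul1 // !mul1r.
- rewrite sweedler_comul_x ?(kp_comul_g A_kp) // !mulrA.
  by rewrite !kp_wordE mul1r.
- rewrite sweedler_comul_x ?(kp_comul_h A_kp) // !mulrA.
  by rewrite !kp_wordE mul1r.
- rewrite sweedler_comul_x ?kp_comul_gh // !mulrA.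
  by rewrite !kp_wordE mul1r.
Qed.

(** * The polynomial system and its solutions *)

(* The arguments are the values at [g, h, gh, x, gx, hx, ghx]; in [KpSub] the
   booleans tell which of [g, h, gh] lie in a subgroup. *)
Variant kp_solution : k -> k -> k -> k -> k -> k -> k -> Prop :=
| KpCounit : kp_solution 1 1 1 1 1 1 1
| KpZeta zeta of zeta ^+ 2 = -1 :
    kp_solution 0 0 1
      ((1 + zeta) / 2) ((1 - zeta) / 2) ((1 - zeta) / 2) ((1 + zeta) / 2)
| KpSub (a b c : bool) of (a && b ==> c) && (a && c ==> b) && (b && c ==> a) :
    kp_solution a%:R b%:R c%:R 0 0 0 0.

(* Twice the defining identity of a partial action at [u = wx] and
   [v = 1, g, h, gh], for [w] grouplike, where [a, b, c] are the values at
   [g, h, gh] and [p, r, s, t] those at [wx, wgx, whx, wghx]. *)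
Definition kp_x_equations (a b c p r s t : k) : Prop :=
  [/\ 2 * p = p * p + p * r + s * p - s * r,
      2 * p * a = p * s + p * t + s * s - s * t,
      2 * p * b = p * r + p * p + s * r - s * p &
      2 * p * c = p * t + p * s + s * t - s * s].

(** If p is nonzero, the equations for [a] and [c] add up to 2p(s + t) = 0. With t = -s the one for
    [a] becomes 2s^2 = 0, and with s = 0 those for 1 and [b] give 2p = 0. *)
Lemma kp_x_equations_trivial (p r s t : k) :
  kp_x_equations 0 0 0 p r s t -> p = 0.
Proof.
rewrite /kp_x_equations !mulr0 => -[e1 ea eb ec].
have [//|p_neq0] := eqVneq p 0.
have st0 : s + t = 0.
  apply: (mulfI p_neq0); apply: (mulfI two_neq0).
  by rewrite !mulr0 -[RHS]addr0 {1}ea ec; ring.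
have ts : t = - s by apply/eqP; rewrite -addr_eq0 addrC st0.
have s0 : s = 0.
  have: 2 * (s * s) = 0 by rewrite [RHS]ea ts; ring.
  by move/eqP; rewrite !mulf_eq0 (negPf two_neq0) orbb => /eqP.
by apply: (mulfI two_neq0); rewrite mulr0 e1 [RHS]eb s0; ring.
Qed.

(** The first three hypotheses come from u = g, h, gh, and the last four from u = x, gx, hx, ghx,
    where left translation by G(A) permutes p, r, s, t. *)
Lemma kp_solutionP (a b c p r s t : k) :
  [/\ a * a = a, a * b = a * c, a * p = a * r & a * s = a * t] ->
  [/\ b * b = b, b * a = b * c, b * p = b * s & b * r = b * t] ->
  [/\ c * c = c, c * p = c * t & c * r = c * s] ->
  kp_x_equations a b c p r s t -> kp_x_equations a b c r p t s ->
  kp_x_equations a b c s t p r -> kp_x_equations a b c t s r p ->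
  kp_solution a b c p r s t.
Proof.
have idem (y : k) : y * y = y -> y = 0 \/ y = 1.
  move=> /eqP; rewrite -subr_eq0 -{3}[y]mulr1 -mulrBr mulf_eq0 subr_eq0.
  by case/orP=> /eqP ->; [left | right].
case=> /idem aa ab apr ast [/idem bb ba bps brt] [/idem cc cpt crs] Xp Xr Xs Xt.
case: aa bb => ?; subst a.
  case=> ?; subst b.
    case: cc => ?; subst c.
      rewrite (kp_x_equations_trivial Xp) (kp_x_equations_trivial Xr).
      rewrite (kp_x_equations_trivial Xs) (kp_x_equations_trivial Xt).
      exact: (@KpSub false false false isT).
    move: cpt crs; rewrite !mul1r => ? ?; subst t s.
    case: Xp; rewrite !mulr0 => e1 ea _ _.
    have [p0|p_neq0] := eqVneq p 0.
      have: r * r = 0 by rewrite [RHS]ea p0; ring.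
      move/eqP; rewrite mulf_eq0 orbb p0 => /eqP ->.
      exact: (@KpSub false false true isT).
    (* Adding p^2 + r^2 = 0 to 2p = p^2 + 2pr - r^2 gives 2p = 2p(p + r). *)
    have rE : r = 1 - p.
      apply: (mulfI p_neq0); apply: (mulfI two_neq0).
      by rewrite mulrBr mulr1 mulrBr e1 -[RHS]addr0 {1}ea; ring.
    have := @KpZeta (2 * p - 1).
    have -> : (1 + (2 * p - 1)) / 2 = p by field.
    have -> : (1 - (2 * p - 1)) / 2 = r by rewrite rE; field.
    (* Here zeta^2 + 1 = 2(p^2 + r^2), which is 0 by [ea]. *)
    apply; apply/eqP; rewrite -subr_eq0; apply/eqP.
    transitivity (2 * (0 : k)); last by rewrite mulr0.
    by rewrite ea rE; ring.
  move: ba bps brt; rewrite !mul1r => ? ? ?; subst c s t.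
  (* The equations at v = 1 and v = g share the right-hand side 2y^2, and the second has left-hand
     side 0. *)
  have X0 (y z : k) : kp_x_equations 0 1 0 y z y z -> y = 0.
    case; rewrite !mulr0 => e1 ea _ _.
    by apply: (mulfI two_neq0); rewrite mulr0 e1 [RHS]ea; ring.
  rewrite (X0 _ _ Xp) (X0 _ _ Xr); exact: (@KpSub false true false isT).
move: ab apr ast; rewrite !mul1r => ? ? ?; subst c r t.
case=> ?; subst b.
  have X0 (y z : k) : kp_x_equations 1 0 0 y y z z -> y = 0.
    case; rewrite !mulr0 => e1 _ eb _.
    by apply: (mulfI two_neq0); rewrite mulr0 e1 [RHS]eb; ring.
  rewrite (X0 _ _ Xp) (X0 _ _ Xs); exact: (@KpSub true false false isT).
move: bps; rewrite !mul1r => ?; subst s.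
case: Xp => e1 _ _ _.
have /idem[->|->] : p * p = p by apply: (mulfI two_neq0); rewrite e1; ring.
  exact: (@KpSub true true true isT).
exact: KpCounit.
Qed.

(** * From partial actions to solutions, and from solutions to symmetry *)

Section Functional.
Variable f : {linear A -> k^o}.
Hypothesis f1 : f 1 = 1.

Let linf : linear f := @linearP _ _ _ _ f.

Let linM v : linear (fun b => f (b * v)).
Proof. by move=> c y z; rewrite mulrDl linearD -scalerAl linearZ. Qed.

Let linMr b : linear (fun v => f (b * v)).
Proof. by move=> c y z; rewrite mulrDr linearD -scalerAr linearZ. Qed.

Let f_xx u v w y :
  f (2^-1 *: (u + v + w - y)) = 2^-1 * (f u + f v + f w - f y).
Proof. by rewrite linearZ linearB !linearD. Qed.

Lemma partial_action_kp_solution :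
  partial_action f ->
  kp_solution (f g) (f h) (f (g * h)) (f x) (f (g * x)) (f (h * x))
    (f (g * h * x)).
Proof.
case=> _ fM.
have E v := @kp_sweedlerE (fun a b => f a * f (b * v) : k^o)
  (fun _ => mull_linear _ linf) (fun _ => mulr_linear _ (linM v)).
have doubleM u v w : 2^-1 * w = f u * f v -> 2 * f u * f v = w.
  by move=> e; rewrite -mulrA -e; field.
have double1 u w : 2^-1 * w = f u * f 1 -> 2 * f u = w.
  by move/doubleM <-; rewrite f1 mulr1.
apply: kp_solutionP; split.
(* Eleven goals have u in G(A); the other sixteen have u in G(A)x and need the factor 1/2 of the
   coproduct cleared. *)
1-11: by rewrite fM E ?mulrA ?kp_wordE ?mul1r ?f1 ?mulr1.
all: (apply: double1 || apply: doubleM).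
all: by rewrite fM E ?mulrA ?(kp_wordE, mul1r, mulr1).
Qed.

(** Since the conclusion includes [partial_action f], this also yields the converse half of the
    classification. *)
Lemma kp_solution_symmetric :
  kp_solution (f g) (f h) (f (g * h)) (f x) (f (g * x)) (f (h * x))
    (f (g * h * x)) ->
  symmetric_partial_action f.
Proof.
move=> fP; split; first (split=> //).
  apply: (@kp_bilinear_ext f (fun v a b => f a * f (b * v))).
    by move=> a b; apply: mulr_linear.
  have E v := @kp_sweedlerE (fun a b => f a * f (b * v) : k^o)
    (fun _ => mull_linear _ linf) (fun _ => mulr_linear _ (linM v)).
  (* Each of the 64 basis pairs is checked for each family of solutions; [abc] discards the boolean
     triples that are not subgroups. *)
  apply: kp_basis_forall; apply: kp_basis_forall;
    rewrite E ?mulrA ?(kp_wordE, mulr1, mul1r) ?f_xx ?f1;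
    (case: fP => [|zeta z2|a b c abc];
      [by field | by field: z2 |
       rewrite ?(mul0r, mulr0, addr0, subr0) //;
       by case: a b c abc => [] [] [] //= _; ring]).
apply: (@kp_bilinear_ext f (fun v a b => f (a * v) * f b)).
  by move=> a b; apply: mull_linear.
have E v := @kp_sweedlerE (fun a b => f (a * v) * f b : k^o)
  (fun _ => mull_linear _ (linM v)) (fun _ => mulr_linear _ linf).
apply: kp_basis_forall; apply: kp_basis_forall;
  rewrite E ?mulrA ?(kp_wordE, mulr1, mul1r) ?f_xx ?f1;
  (case: fP => [|zeta z2|a b c abc];
      [by field | by field: z2 |
       rewrite ?(mul0r, mulr0, addr0, subr0) //;
       by case: a b c abc => [] [] [] //= _; ring]).
Qed.

End Functional.

(** * Functionals given by basis values, and subgroups of G(A) *)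

Lemma kp_basis_mapE (c0 c1 c2 c3 c4 c5 c6 c7 : k) :
  let f := basis_map B [tuple c0; c1; c2; c3; c4; c5; c6; c7] in
  (f 1 = c0) * (f g = c1) * (f h = c2) * (f (g * h) = c3) *
  (f x = c4) * (f (g * x) = c5) * (f (h * x) = c6) * (f (g * h * x) = c7).
Proof.
move=> f; have E i (lti : (i < 8)%N) := basis_map_tnth
  [tuple c0; c1; c2; c3; c4; c5; c6; c7] (Ordinal lti) kp_free.
do ?apply: pair.
- exact: (E 0 isT).
- exact: (E 1 isT).
- exact: (E 2 isT).
- exact: (E 3 isT).
- exact: (E 4 isT).
- exact: (E 5 isT).
- exact: (E 6 isT).
- exact: (E 7 isT).
Qed.

(** The coefficient of t (x) t in Delta(t) is 1/2, while it would be 1 for a grouplike t. The tuples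
    below are the dual basis vectors reading it off. *)
Lemma kp_x_not_grouplike t :
  t \in [:: x; g * x; h * x; g * h * x] -> ~ grouplike t.
Proof.
pose F (c : 8.-tuple k) (a b : A) : k^o := basis_map B c a * basis_map B c b.
have linl c b : linear (F c ^~ b) by apply: mull_linear; apply: basis_map_linear.
have linr c a : linear (F c a) by apply: mulr_linear; apply: basis_map_linear.
have half : 2^-1 <> 1 :> k.
  move/(congr1 GRing.inv); rewrite invrK invr1 => /eqP.
  by rewrite -subr_eq0 -[1 in X in _ - X]/(1%:R) -natrB // oner_eq0.
move=> tx [_ tt]; apply: half; have P c := sweedler_pure t t (linl c) (linr c).
rewrite -{}tt in P; move: P; rewrite !inE in tx.
have zeros := (mulr0, mul0r, mulr1, subr0, addr0).
case/or4P: tx => /eqP-> P.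
- have := P [tuple 0; 0; 0; 0; 1; 0; 0; 0].
  by rewrite kp_sweedlerE // /F !kp_basis_mapE !zeros.
- have := P [tuple 0; 0; 0; 0; 0; 1; 0; 0].
  by rewrite kp_sweedlerE // /F !kp_basis_mapE !zeros.
- have := P [tuple 0; 0; 0; 0; 0; 0; 1; 0].
  by rewrite kp_sweedlerE // /F !kp_basis_mapE !zeros.
- have := P [tuple 0; 0; 0; 0; 0; 0; 0; 1].
  by rewrite kp_sweedlerE // /F !kp_basis_mapE !zeros.
Qed.

Lemma x_notin_grouplike_subgroup (N : {pred A}) t :
  grouplike_subgroup N -> t \in [:: x; g * x; h * x; g * h * x] ->
  (t \in N) = false.
Proof. by case=> NG _ tx; apply/negP => /NG; apply: kp_x_not_grouplike. Qed.

Lemma lambda_subE (N : {pred A}) :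
  lambda_sub g h x N =1 basis_map B [tuple (1 \in N)%:R; (g \in N)%:R;
    (h \in N)%:R; (g * h \in N)%:R; (x \in N)%:R; (g * x \in N)%:R;
    (h * x \in N)%:R; (g * h * x \in N)%:R].
Proof. by move=> u; congr (basis_map _ _ u); apply: val_inj. Qed.

(** As g and h are involutions, closure under quotients yields the three implications of [KpSub]. *)
Lemma lambda_sub_solution (N : {pred A}) (f : {linear A -> k^o}) :
  grouplike_subgroup N -> f =1 lambda_sub g h x N ->
  f 1 = 1 /\
  kp_solution (f g) (f h) (f (g * h)) (f x) (f (g * x)) (f (h * x))
    (f (g * h * x)).
Proof.
move=> NP fN; have xN t := @x_notin_grouplike_subgroup N t NP.
case: NP => _ [N1 Ndiv]; rewrite !fN !lambda_subE !kp_basis_mapE N1; split=> //.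
rewrite (xN x) ?(xN (g * x)) ?(xN (h * x)) ?(xN (g * h * x)) ?inE ?eqxx ?orbT //.
apply: KpSub.
have gV := invr_involution gg; have hV := invr_involution hh.
apply/andP; split; first (apply/andP; split); apply/implyP => /andP[uN vN].
- by have := Ndiv _ _ uN vN; rewrite hV.
- by have := Ndiv _ _ vN uN; rewrite gV -(kp_hg A_kp) -mulrA gg mulr1.
- by have := Ndiv _ _ vN uN; rewrite hV -mulrA hh mulr1.
Qed.

Lemma kp_subgroup (a b c : bool) :
  (a && b ==> c) && (a && c ==> b) && (b && c ==> a) ->
  exists2 N : {pred A}, grouplike_subgroup N &
    [/\ (g \in N) = a, (h \in N) = b, (g * h \in N) = c & 1 \in N].
Proof.
(* Freeness makes 1, g, h, gh pairwise distinct, so membership in the predicate below recovers a, b,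
   c. *)
move=> abc; have := free_uniq kp_free; rewrite /= !inE !negb_or.
case/and4P=> /and4P[g1 h1 gh1 _] /and4P[gh ggh _ _] /and4P[hgh _ _ _] _.
rewrite eq_sym in g1; rewrite eq_sym in h1; rewrite eq_sym in gh1.
exists [pred u | [|| u == 1, a && (u == g), b && (u == h) | c && (u == g * h)]].
  have gV := invr_involution gg; have hV := invr_involution hh.
  have ghV : (g * h)^-1 = g * h.
    by apply: invr_involution; rewrite mulrA !kp_wordE.
  split=> [u uN|].
    have uG : u \in [:: 1; g; h; g * h].
      move: uN; rewrite !inE.
      by case/or4P=> [->|/andP[_ ->]|/andP[_ ->]|/andP[_ ->]]; rewrite ?orbT.
    split.
      apply: (free_not0 kp_free).
      by rewrite (mem_cat u [:: 1; g; h; g * h] [:: x; _; _; _]) uG.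
    move: uG; rewrite !inE => /or4P[] /eqP ->.
    - exact: comul1.
    - exact: (kp_comul_g A_kp).
    - exact: (kp_comul_h A_kp).
    - exact: kp_comul_gh.
  split=> [|u v]; first by rewrite inE eqxx.
  rewrite !inE; case: a b c abc => [] [] [] //= _;
    rewrite ?orbF;
    do ![case/predU1P => [->|] | move/eqP => ->];
    by rewrite ?(invr1, ghV, gV, hV) ?mulrA ?(kp_wordE, mulr1, mul1r) eqxx
      ?orbT.
rewrite !inE !eqxx [h == g]eq_sym [g * h == g]eq_sym [g * h == h]eq_sym.
rewrite (negPf g1) (negPf h1) (negPf gh1) (negPf gh) (negPf ggh) (negPf hgh).
by rewrite !andbF !andbT !orbF; split.
Qed.

Lemma kp_solutionE (f : {linear A -> k^o}) :
  f 1 = 1 ->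
  kp_solution (f g) (f h) (f (g * h)) (f x) (f (g * x)) (f (h * x))
    (f (g * h * x)) ->
  [\/ f =1 counit,
      exists2 zeta : k, zeta ^+ 2 = -1 & f =1 lambda_zeta g h x zeta
    | exists2 N : {pred A}, grouplike_subgroup N & f =1 lambda_sub g h x N].
Proof.
have ext (f' : {linear A -> k^o}) : f 1 = f' 1 -> f g = f' g -> f h = f' h ->
    f (g * h) = f' (g * h) -> f x = f' x -> f (g * x) = f' (g * x) ->
    f (h * x) = f' (h * x) -> f (g * h * x) = f' (g * h * x) -> f =1 f'.
  by move=> *; apply: kp_linear_ext; apply: kp_basis_forall.
move=> f1; move fgE: (f g) => fg; move fhE: (f h) => fh.
move fghE: (f (g * h)) => fgh; move fxE: (f x) => fx.
move fgxE: (f (g * x)) => fgx; move fhxE: (f (h * x)) => fhx.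
move fghxE: (f (g * h * x)) => fghx fP.
case: fP fgE fhE fghE fxE fgxE fhxE fghxE => [|zeta z2|a b c abc] *.
- by constructor 1; apply: ext; rewrite (kp_counitP A_kp) ?inE ?eqxx ?orbT.
- constructor 2; exists zeta => //.
  by apply: ext; rewrite /lambda_zeta /= kp_basis_mapE.
- have [N Ngrp [Ng Nh Ngh N1]] := kp_subgroup abc.
  have xN t := @x_notin_grouplike_subgroup N t Ngrp.
  constructor 3; exists N => //; apply: ext.
  all: rewrite lambda_subE kp_basis_mapE ?N1 ?Ng ?Nh ?Ngh //.
  all: by rewrite xN // !inE eqxx ?orbT.
Qed.

End KacPaljutkin.

(** * Classification and symmetry *)

Theorem proposition3p2 (k : closedFieldType) (chark : [pchar k] =i pred0)
    (q : k) (q_prim : 4.-primitive_root q)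
    (A : hopfAlgebra k) (g h x : A) (A_kp : kac_paljutkin g h x) :
  (forall lambda : {linear A -> k^o},
     partial_action lambda <->
     [\/ lambda =1 counit,
         exists2 zeta : k,
           zeta \in [:: q; - q] & lambda =1 lambda_zeta g h x zeta
       | exists2 N : {pred A},
           grouplike_subgroup N & lambda =1 lambda_sub g h x N])
  /\ (forall lambda : {linear A -> k^o},
        partial_action lambda -> symmetric_partial_action lambda).
Proof.
have two_neq0 : 2 != 0 :> k by rewrite (proj1 (pcharf0P k) chark).
(* The square of q squares to 1 but is not 1, as 4 does not divide 2; so q and -q are exactly the
   zeta allowed in [KpZeta]. *)
have q2 : q ^+ 2 = -1.
  have: (q ^+ 2) ^+ 2 == 1 by rewrite -exprM (prim_expr_order q_prim).
  by rewrite sqrf_eq1 -(prim_order_dvd q_prim) => /eqP.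
have zetaP zeta : (zeta \in [:: q; - q]) = (zeta ^+ 2 == -1).
  by rewrite !inE -q2 eqf_sqr.
have sym (f : {linear A -> k^o}) :=
  @kp_solution_symmetric k A g h x two_neq0 A_kp f.
split=> [f|f fP]; last first.
  by apply: sym; [case: fP | apply: partial_action_kp_solution => //; case: fP].
split=> [fP|].
  have f1 : f 1 = 1 by case: fP.
  have fS := partial_action_kp_solution two_neq0 A_kp f1 fP.
  have [] := kp_solutionE A_kp f1 fS.
  - by constructor 1.
  - by case=> zeta /eqP z2 fz; constructor 2; exists zeta; rewrite ?zetaP.
  - by constructor 3.
case=> [fE|[zeta]|[N Ngrp fE]].
- have fB t : t \in kp_basis g h x -> f t = 1.
    by move=> tB; rewrite fE (kp_counitP A_kp).
  apply: (proj1 (sym f _ _)); rewrite !fB ?inE ?eqxx ?orbT //; exact: KpCounit.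
- rewrite zetaP => /eqP z2 fE.
  apply: (proj1 (sym f _ _)); rewrite !fE /lambda_zeta /= !kp_basis_mapE //.
  exact: KpZeta.
by have [f1 fS] := lambda_sub_solution A_kp Ngrp fE; apply: (proj1 (sym f _ _)).
Qed.
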